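(* Let $n\geq 4$ be a positive integer. Then: (1) $t(n,3,n-2)=n$; (2) $t(n,3,n-1)=n-1$.
   Context: All graphs are finite, undirected and simple. Let $G$ be a nontrivial connected graph of order $n$ (i.e. with $n$ vertices). An edge-coloring of $G$ is any assignment of colors to the edges (adjacent edges may receive the same color). A tree $T$ that is a subgraph of $G$ is a rainbow tree if no two edges of $T$ have the same color. For $S\subseteq V(G)$ with $|S|\geq 2$, a rainbow $S$-tree is a rainbow tree $T$ in $G$ with $S\subseteq V(T)$. For an integer $k$ with $2\leq k\leq n$, an edge-coloring of $G$ is a $k$-rainbow coloring if for every $k$-subset $S$ of $V(G)$ there exists a rainbow $S$-tree. The $k$-rainbow index $rx_k(G)$ is the minimum number of colors needed in a $k$-rainbow coloring of $G$. For integers $2\leq k\leq n$ and $2\leq\ell\leq n-1$, $t(n,k,\ell)$ denotes the minimum size (number of edges) of a connected graph $G$ of order $n$ with $rx_k(G)\leq \ell$ (when such a graph exists). *)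

(* Defs.v *)
From mathcomp Require Import all_boot.

Set Implicit Arguments.
Unset Strict Implicit.
Unset Printing Implicit Defensive.

Definition is_minimum (P : nat -> Prop) (m : nat) : Prop :=
  P m /\ forall k : nat, P k -> m <= k.

Record graph := Graph {
  vertex :> finType;
  adj : rel vertex;
  adj_sym : symmetric adj;
  adj_irrefl : irreflexive adj
}.

Definition edge_set (V : finType) (r : rel V) : {set {set V}} :=
  [set [set p.1; p.2] | p : V * V & r p.1 p.2].

Definition edges (G : graph) : {set {set G}} := edge_set (@adj G).

Definition connected (G : graph) : Prop :=
  forall x y : G, connect (@adj G) x y.

Record subgraph (G : graph) := Subgraph {
  sub_vertices : {set G};
  sub_adj : rel G;
  sub_adj_sym : symmetric sub_adj;
  sub_adjG : subrel sub_adj (@adj G);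
  sub_adj_vertices : forall x y : G, sub_adj x y -> x \in sub_vertices
}.

Definition sub_edges (G : graph) (H : subgraph G) : {set {set G}} :=
  edge_set (@sub_adj G H).

(* [ucycle] accepts the closed walk [:: x; y] along a single edge, so only
   sequences of at least three distinct vertices are genuine cycles. *)
Definition is_tree (G : graph) (H : subgraph G) : Prop :=
  [/\ sub_vertices H != set0,
      {in sub_vertices H &, forall x y : G, connect (@sub_adj G H) x y}
    & forall p : seq G, 2 < size p -> ~ ucycle (@sub_adj G H) p].

(* Only the values on [edges G] are ever used. *)
Definition edge_coloring (G : graph) := {set G} -> nat.

Definition num_colors (G : graph) (c : edge_coloring G) : nat :=
  size (undup [seq c e | e <- enum (edges G)]).

Definition rainbow (G : graph) (c : edge_coloring G) (H : subgraph G) : Prop :=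
  {in sub_edges H &, injective c}.

Definition rainbow_coloring (k : nat) (G : graph) (c : edge_coloring G) : Prop :=
  forall S : {set G}, #|S| = k ->
    exists H : subgraph G,
      [/\ is_tree H, rainbow c H & S \subset sub_vertices H].

(* rx_k(G) = r *)
Definition is_rainbow_index (k : nat) (G : graph) (r : nat) : Prop :=
  is_minimum
    (fun m => exists c : edge_coloring G,
       rainbow_coloring k c /\ num_colors c = m) r.

(* t(n, k, l) = s; this includes the existence of a graph as required. *)
Definition is_min_size (n k l s : nat) : Prop :=
  is_minimum
    (fun m => exists G : graph,
       [/\ #|G| = n, connected G,
           exists r : nat, is_rainbow_index k G r /\ r <= l
         & #|edges G| = m]) s.

(* Main.v *)
Require Import Defs.
From mathcomp Require Import all_boot.
From Stdlib Require Import Classical.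
From mathcomp Require Import zify.

(** A connected graph of order [n] has at least [n - 1] edges, so in one with
    exactly [n - 1] edges every edge is a bridge.  Given two edges [e = xy] and
    [f] there, one end [w] of [f] is separated from [x] by [f], hence every tree
    through [x], [y], [w] uses both [e] and [f]: a 3-rainbow coloring gives all
    edges different colors.  This is the lower bound.  The upper bounds come
    from a star, and from a 4-cycle with pendant edges at one vertex whose cycle
    is colored alternately: three vertices either miss a non-hub vertex of the
    cycle, which can be deleted, or lie on a path of length 2 of the cycle. *)

Set Implicit Arguments.
Unset Strict Implicit.
Unset Printing Implicit Defensive.

(** * Minima and counts of colors *)

(** Well-ordering by strong descent from [m]. Since [P] is an arbitrary proposition, the existence
    of a smaller witness is decided by excluded middle. *)
Lemma is_minimum_exists (P : nat -> Prop) (m : nat) :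
  P m -> exists r, is_minimum P r /\ r <= m.
Proof.
elim/ltn_ind: m => m IHm Pm.
have [[k [Pk lt_km]]|no_k] := classic (exists k, P k /\ k < m).
  have [r [min_r le_rk]] := IHm k lt_km Pk.
  by exists r; split=> //; apply: leq_trans le_rk (ltnW lt_km).
exists m; split=> //; split=> // k Pk; rewrite leqNgt; apply/negP => lt_km.
by apply: no_k; exists k.
Qed.

Lemma rainbow_index_le (k : nat) (G : graph) (c : edge_coloring G) (l : nat) :
  rainbow_coloring k c -> num_colors c <= l ->
  exists r, is_rainbow_index k G r /\ r <= l.
Proof.
move=> rc le_cl.
have [|r [min_r le_r]] := @is_minimum_exists (fun m =>
    exists c : edge_coloring G, rainbow_coloring k c /\ num_colors c = m)
  (num_colors c); first by exists c.
by exists r; split=> //; apply: leq_trans le_r le_cl.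
Qed.

Lemma num_colors_le (G : graph) (c : edge_coloring G) :
  num_colors c <= #|edges G|.
Proof. by rewrite /num_colors (leq_trans (size_undup _)) // size_map -cardE. Qed.

Lemma num_colors_lt (G : graph) (c : edge_coloring G) :
  num_colors c < #|edges G| ->
  exists e f, [/\ e \in edges G, f \in edges G, e != f & c e = c f].
Proof.
move=> lt_c.
have /dinjectivePn [e eE [f]] : ~~ dinjectiveb c (edges G).
  apply: contraTN lt_c => inj_c; rewrite -leqNgt /num_colors undup_id //.
  by rewrite size_map -cardE.
rewrite !inE => /andP [ne_fe fE] eq_c.
by exists e, f; rewrite eq_sym.
Qed.

(** * Edge counts and bridges *)

Lemma edge_setP (V : finType) (r : rel V) (e : {set V}) :
  reflect (exists x y, r x y /\ e = [set x; y]) (e \in edge_set r).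
Proof.
apply: (iffP imsetP) => [[[x y]]|[x [y [rxy ->]]]].
  by rewrite inE /= => rxy ->; exists x, y.
by exists (x, y); rewrite ?inE.
Qed.

Lemma crossing_edge (V : finType) (r : rel V) (A : {set V}) (x z : V) :
  x \in A -> z \notin A -> connect r x z ->
  exists a b, [/\ a \in A, b \notin A & r a b].
Proof.
move=> xA zA /connectP [p]; elim: p x xA => [|b p IHp] a aA /=.
  by move=> _ def_z; rewrite def_z aA in zA.
case/andP => rab pbp def_z; have [bA|bA] := boolP (b \in A).
  exact: IHp bA pbp def_z.
by exists a, b.
Qed.

(** Grow a vertex set one vertex at a time along an edge that leaves it. That edge does not lie
    inside the old set, so each new vertex brings a new edge. *)
Lemma connected_card_edges (V : finType) (r : rel V) :
  (forall x y, connect r x y) -> #|V| <= #|edge_set r|.+1.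
Proof.
move=> conn.
have grow k : k < #|V| ->
    exists A : {set V}, #|A| = k.+1 /\ k <= #|[set e in edge_set r | e \subset A]|.
  elim: k => [|k IHk] lt_k.
    by case/card_gt0P: lt_k => x _; exists [set x]; rewrite cards1.
  have [A [cardA leA]] := IHk (ltnW lt_k).
  have /card_gt0P [x xA] : 0 < #|A| by rewrite cardA.
  have /card_gt0P [z] : 0 < #|~: A| by rewrite cardsCs setCK cardA subn_gt0.
  rewrite inE => zA.
  have [a [b [aA bA rab]]] := crossing_edge xA zA (conn x z).
  exists (b |: A); rewrite cardsU1 bA cardA; split=> //.
  have notin : [set a; b] \notin [set e in edge_set r | e \subset A].
    by rewrite inE subUset !sub1set (negbTE bA) !andbF.
  apply: (@leq_trans #|[set a; b] |: [set e in edge_set r | e \subset A]|).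
    by rewrite cardsU1 notin ltnS.
  apply/subset_leq_card/subsetP => e; rewrite !inE => /orP [/eqP->|/andP [eE eA]].
    rewrite subUset !sub1set !inE eqxx aA orbT andbT.
    by apply/edge_setP; exists a, b.
  by rewrite eE (subset_trans eA) // subsetUr.
case def_n : #|V| => [//|k].
have [|A [_ leA]] := grow k; first by rewrite def_n.
rewrite ltnS (leq_trans leA) // subset_leq_card //.
by apply/subsetP => e; rewrite inE => /andP [].
Qed.

Definition delete_edge (V : finType) (r : rel V) (e : {set V}) : rel V :=
  fun x y => r x y && ([set x; y] != e).

Lemma edge_set_delete (V : finType) (r : rel V) (e : {set V}) :
  edge_set (delete_edge r e) = edge_set r :\ e.
Proof.
apply/setP => f; rewrite in_setD1; apply/edge_setP/andP.
  case=> x [y [/andP [rxy ne] ->]]; split=> //.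
  by apply/edge_setP; exists x, y.
case=> ne /edge_setP [x [y [rxy def_f]]].
by exists x, y; rewrite /delete_edge rxy -def_f ne.
Qed.

Lemma connect_delete_sym (V : finType) (r : rel V) (e : {set V}) :
  symmetric r -> connect_sym (delete_edge r e).
Proof.
by move=> r_sym; apply: sym_connect_sym => x y; rewrite /delete_edge r_sym setUC.
Qed.

(** If the ends stayed connected, removing the edge would leave a connected graph with fewer than
    [#|V| - 1] edges. *)
Lemma tree_edge_bridge (V : finType) (r : rel V) (x y : V) :
  symmetric r -> (forall u v, connect r u v) -> #|edge_set r| < #|V| ->
  r x y -> ~~ connect (delete_edge r [set x; y]) x y.
Proof.
move=> r_sym conn few rxy; apply/negP => cxy.
have : #|V| <= #|edge_set (delete_edge r [set x; y])|.+1.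
  apply: connected_card_edges => u v; apply: connect_sub (conn u v) => a b rab.
  (* A step along the deleted edge, in either direction, is replaced by the detour [cxy]. *)
  have [eq_e|ne_e] := eqVneq [set a; b] [set x; y]; last first.
    by apply: connect1; rewrite /delete_edge rab.
  have : a \in [set x; y] by rewrite -eq_e !inE eqxx.
  have : b \in [set x; y] by rewrite -eq_e !inE eqxx orbT.
  rewrite !inE => /orP [] /eqP -> /orP [] /eqP -> //.
  by rewrite connect_delete_sym.
rewrite edge_set_delete => le_V.
have eE : [set x; y] \in edge_set r by apply/edge_setP; exists x, y.
by move: few; rewrite (cardsD1 [set x; y]) eE add1n ltnNge le_V.
Qed.

Lemma subgraph_uses_bridge (G : graph) (H : subgraph G) (e : {set G}) (x y : G) :
  connect (@sub_adj G H) x y -> ~~ connect (delete_edge (@adj G) e) x y ->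
  e \in sub_edges H.
Proof.
move=> cH; apply: contraNT => eH; apply: connect_sub cH => a b Hab.
apply: connect1; rewrite /delete_edge (sub_adjG Hab) /=.
by apply: contraNneq eH => <-; apply/edge_setP; exists a, b.
Qed.

(** * The lower bound *)

Lemma tree_rainbow_colors (G : graph) (c : edge_coloring G) :
  connected G -> #|edges G| < #|G| -> rainbow_coloring 3 c ->
  #|edges G| <= num_colors c.
Proof.
move=> conn few rc; rewrite leqNgt; apply/negP => /num_colors_lt.
case=> e [f [eE fE ne_ef eq_c]].
have bridge := tree_edge_bridge (@adj_sym G) conn few.
case/edge_setP: (eE) => x [y [rxy def_e]].
case/edge_setP: (fE) => u [v [ruv def_f]].
have nc_xy : ~~ connect (delete_edge (@adj G) e) x y by rewrite def_e bridge.
(* Otherwise [x] would reach both ends of [f] without using [f], which is a bridge. *)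
have [w nc_xw] : exists w, ~~ connect (delete_edge (@adj G) f) x w.
  apply/existsP; apply: contraTT (bridge u v ruv).
  rewrite negb_exists => /forallP cx; rewrite -def_f negbK.
  apply: (@connect_trans _ _ x); last by have := cx v; rewrite negbK.
  by rewrite connect_delete_sym; [have := cx u; rewrite negbK | apply: adj_sym].
have ne_xy : x != y by apply: contraTneq rxy => ->; rewrite adj_irrefl.
have ne_xw : x != w by apply: contraNneq nc_xw => ->.
(* The edge [e], being different from [f], still joins [x] to [y] once [f] is deleted. *)
have ne_yw : y != w.
  apply: contraNneq nc_xw => <-; apply: connect1.
  by rewrite /delete_edge rxy -def_e.
have cardS : #|w |: [set x; y]| = 3.
  by rewrite cardsU1 cards2 ne_xy !inE negb_or eq_sym ne_xw eq_sym ne_yw.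
have [H [[_ connH _] rH /subsetP sH]] := rc _ cardS.
have xH : x \in sub_vertices H by apply: sH; rewrite !inE eqxx orbT.
have yH : y \in sub_vertices H by apply: sH; rewrite !inE eqxx !orbT.
have wH : w \in sub_vertices H by apply: sH; rewrite !inE eqxx.
move/negP: ne_ef; apply; apply/eqP; apply: rH eq_c.
  exact: subgraph_uses_bridge (connH _ _ xH yH) nc_xy.
exact: subgraph_uses_bridge (connH _ _ xH wH) nc_xw.
Qed.

Lemma rainbow_index_edges (G : graph) (r : nat) :
  connected G -> is_rainbow_index 3 G r -> r < #|G|.-1 -> #|G| <= #|edges G|.
Proof.
move=> conn [[c [rc <-]] _] lt_r; rewrite leqNgt; apply/negP => few.
have := connected_card_edges conn; rewrite -/(edges G).
have := tree_rainbow_colors conn few rc; lia.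
Qed.

(** * Rainbow trees from parent functions *)

(* In a cycle, both neighbors of a vertex of maximal rank are its parent. *)
Lemma ranked_acyclic (V : finType) (r : rel V) (f : V -> V) (d : V -> nat)
    (p : seq V) :
  symmetric r -> (forall x y, r x y -> d y <= d x -> y = f x) ->
  2 < size p -> ~ ucycle r p.
Proof.
move=> r_sym parent gt2 ucp.
have [x0 x0p] : exists x, x \in p.
  by case: p gt2 {ucp} => // x s _; exists x; rewrite mem_head.
have [x xp max_x] : exists2 x, x \in p & forall y, y \in p -> d y <= d x.
  by case: (@arg_maxnP _ x0 (mem p) d x0p) => x xp max_x; exists x.
case: (rot_to xp) => i s def_s.
have memp y : y \in x :: s -> d y <= d x.
  by rewrite -def_s mem_rot; apply: max_x.
move: ucp; rewrite -(rot_ucycle i) def_s.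
have : 2 < size (x :: s) by rewrite -def_s size_rot.
case: s memp {def_s} => [//|y [//|z s]] memp _.
rewrite /ucycle (cycle_path x) [last _ _]/= => /andP [].
rewrite [path _ _ _]/= => /and3P [rlx rxy _].
rewrite !cons_uniq => /and3P [_ /negP y_notin _]; apply: y_notin.
have -> : y = f x by apply: parent => //; apply: memp; rewrite !inE eqxx orbT.
have <- : last z s = f x.
  by apply: parent; rewrite 1?r_sym //; apply: memp; rewrite 2!inE mem_last !orbT.
exact: mem_last.
Qed.

(** Every tree of the constructions below comes from here. The strictly decreasing rank [d] leads
    each vertex to the root [t] and excludes cycles. The edges are indexed by the vertices other
    than [t], so being rainbow amounts to injectivity of the color of the parent edge. *)
Lemma parent_tree (G : graph) (A : {set G}) (t : G) (f : G -> G) (d : G -> nat)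
    (c : edge_coloring G) :
  t \in A ->
  {in A :\ t, forall x, [/\ f x \in A, adj x (f x) & d (f x) < d x]} ->
  {in A :\ t &, injective (fun x => c [set x; f x])} ->
  exists H : subgraph G, [/\ is_tree H, rainbow c H & sub_vertices H = A].
Proof.
move=> tA parent inj_c.
pose arc x y := (x \in A :\ t) && (y == f x).
pose r x y := arc x y || arc y x.
have r_sym : symmetric r by move=> x y; rewrite /r orbC.
have rG : subrel r (@adj G).
  move=> x y /orP [] /andP [xA /eqP ->]; have [_ a _] := parent _ xA => //.
  by rewrite adj_sym.
have rA x y : r x y -> x \in A.
  case/orP => /andP [xA /eqP def]; first by case/setD1P: xA.
  by rewrite def; case: (parent _ xA).
exists (Subgraph r_sym rG rA); split=> //=; last first.
  move=> e1 e2.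
  have rep e : e \in edge_set r -> exists2 x, x \in A :\ t & e = [set x; f x].
    case/edge_setP => x [y [/orP [] /andP [xA /eqP ->] ->]]; first by exists x.
    by exists y; rewrite // setUC.
  move=> /rep [x xA ->] /rep [y yA ->] eq_c.
  by rewrite (inj_c x y xA yA eq_c).
split; first by apply/set0Pn; exists t.
  have to_t x : x \in A -> connect r x t.
    elim/ltn_ind: {x}(d x) {-2}x (erefl (d x)) => n IHn x def_n xA.
    have [->//|ne_xt] := eqVneq x t.
    have xA' : x \in A :\ t by rewrite in_setD1 ne_xt.
    have [fA _ lt_d] := parent _ xA'.
    apply: (@connect_trans _ _ (f x)).
      by apply: connect1; rewrite /r /arc xA' eqxx.
    by apply: (IHn (d (f x))); rewrite -?def_n.
  move=> x y /to_t cx /to_t cy; apply: connect_trans cx _.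
  by rewrite (sym_connect_sym r_sym).
move=> p; apply: (@ranked_acyclic _ _ f d) => // x y.
case/orP => /andP [xA /eqP //]; have [_ _ lt_d] := parent _ xA.
by move=> def_x; rewrite def_x leqNgt lt_d.
Qed.

(** * The two extremal graphs, on [m.+4] vertices *)

Section Examples.

Variable m : nat.

Let V := 'I_m.+4.
Let v1 : V := @Ordinal m.+4 1 isT.
Let v2 : V := @Ordinal m.+4 2 isT.
Let v3 : V := @Ordinal m.+4 3 isT.

(** The exclusive or keeps the center from being its own neighbor. *)
Definition star_adj : rel V := fun x y => (x == ord0) (+) (y == ord0).

Lemma star_adj_sym : symmetric star_adj.
Proof. by move=> x y; rewrite /star_adj addbC. Qed.

Lemma star_adj_irrefl : irreflexive star_adj.
Proof. by move=> x; rewrite /star_adj addbb. Qed.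

Definition star : graph := Graph star_adj_sym star_adj_irrefl.

Lemma star_connected : connected star.
Proof.
have to0 x : connect star_adj x ord0.
  have [->//|ne0] := eqVneq x ord0.
  by apply: connect1; rewrite /star_adj (negbTE ne0).
move=> x y; apply: connect_trans (to0 x) _.
by rewrite (sym_connect_sym star_adj_sym); apply: to0.
Qed.

Lemma card_star_edges : #|edges star| = m.+3.
Proof.
apply/eqP; rewrite eqn_leq; apply/andP; split; last first.
  by have := connected_card_edges star_connected; rewrite card_ord ltnS.
apply: (@leq_trans #|[set [set x; ord0] | x in [set~ ord0 : V]]|).
  apply/subset_leq_card/subsetP => e /edge_setP [x [y [rxy ->]]].
  move: rxy; rewrite /= /star_adj.
  case: eqVneq => [->|nex]; case: eqVneq => [->|ney] //= _.
    by apply/imsetP; exists y; rewrite ?inE // setUC.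
  by apply/imsetP; exists x; rewrite ?inE.
by rewrite (leq_trans (leq_imset_card _ _)) // cardsC1 card_ord.
Qed.

Lemma star_rainbow_coloring :
  exists c : edge_coloring star, rainbow_coloring 3 c.
Proof.
(* All edges get different colors, so the whole star is a rainbow tree for every [S]. *)
pose c : edge_coloring star := fun e => enum_rank e.
exists c => S _.
have [|x|x y|H [treeH rH defA]] := @parent_tree star setT (ord0 : V)
  (fun=> ord0) (fun x => (x : V) != ord0) c.
- by rewrite inE.
- rewrite !inE andbT => ne0.
  by split; rewrite ?inE //= /star_adj ?(negbTE ne0) ?eqxx.
- rewrite !inE !andbT => nex ney /val_inj/enum_rank_inj eq_e.
  have : x \in [set y; ord0] by rewrite -eq_e !inE eqxx.
  by rewrite !inE (negbTE nex) orbF => /eqP.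
by exists H; rewrite defA subsetT.
Qed.

(* A 4-cycle 0-1-2-3 with all the other vertices attached to the hub 0. *)
Definition square_arc : rel V := fun x y =>
  [&& x != ord0, x != v2 & y == ord0] || ((x == v1) || (x == v3)) && (y == v2).

Definition square_adj : rel V := fun x y => square_arc x y || square_arc y x.

Lemma square_adj_sym : symmetric square_adj.
Proof. by move=> x y; rewrite /square_adj orbC. Qed.

Lemma square_adj_irrefl : irreflexive square_adj.
Proof.
move=> x; rewrite /square_adj orbb /square_arc.
by case: x => [[|[|[|[|x]]]] lt_x].
Qed.

Definition square : graph := Graph square_adj_sym square_adj_irrefl.

(** A hub edge has its other end as color, because the maximum ignores the hub 0. The edges from
    [v2] to [v1] and [v3] take the colors 3 and 1 of the opposite edges of the cycle. Hence deleting
    [v1] or [v3] frees exactly the color of the edge from [v2] to the other one. *)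
Definition square_coloring : edge_coloring square := fun e : {set V} =>
  if v2 \in e then (if v3 \in e then 1 else 3) else \max_(x in e) x.

Lemma square_coloring_hub (x : V) : x != v2 ->
  square_coloring [set x; ord0] = x.
Proof.
move=> ne2; rewrite /square_coloring !inE eq_sym (negbTE ne2) /=.
have [->|ne0] := eqVneq x ord0; first by rewrite setUid big_set1.
by rewrite big_setU1 ?inE //= big_set1 maxn0.
Qed.

Lemma square_coloring_21 : square_coloring [set v2; v1] = 3.
Proof. by rewrite /square_coloring !inE. Qed.

Lemma square_coloring_23 : square_coloring [set v2; v3] = 1.
Proof. by rewrite /square_coloring !inE. Qed.

(* Deleting [a] from the square leaves [v2] with the parent [b]. *)
Lemma square_tree_avoiding (a b : V) (S : {set V}) :
  (a, b) \in [:: (v1, v3); (v3, v1)] -> a \notin S ->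
  exists H : subgraph square,
    [/\ is_tree H, rainbow square_coloring H & S \subset sub_vertices H].
Proof.
move=> abP aS.
have [ne0 ne2 colb adjb] : [/\ a != ord0, a != v2,
    square_coloring [set v2; b] = a & square_adj v2 b].
  move: abP; rewrite !inE => /orP [] /eqP [-> ->]; split=> //.
    exact: square_coloring_23.
  exact: square_coloring_21.
have [bne0 bne2 bnea] : [/\ b != ord0, b != v2 & b != a].
  by move: abP; rewrite !inE => /orP [] /eqP [-> ->].
have [|x|x y|H [treeH rH defA]] := @parent_tree square [set~ a] (ord0 : V)
  (fun x => if x == v2 then b else ord0)
  (fun x => if x == v2 then 2 else ((x : V) != ord0))
  square_coloring.
- by rewrite !inE eq_sym.
- rewrite !inE => /andP [xne0 xnea]; have [->|xne2] := eqVneq x v2.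
    by rewrite (negbTE bne2) bne0.
  rewrite eq_sym ne0 /= xne0; split=> //.
  by rewrite /square_adj /square_arc xne0 xne2.
- rewrite !inE => /andP [xne0 xnea] /andP [yne0 ynea].
  have [->|xne2] := eqVneq x v2; have [->|yne2] := eqVneq y v2 => //.
  + by rewrite colb square_coloring_hub // => /val_inj eq_ay; rewrite eq_ay eqxx in ynea.
  + by rewrite colb square_coloring_hub // => /val_inj eq_xa; rewrite eq_xa eqxx in xnea.
  + by rewrite !square_coloring_hub // => /val_inj.
exists H; split=> //; rewrite defA; apply/subsetP => x xS.
by rewrite !inE; apply: contraNneq aS => <-.
Qed.

Lemma square_rainbow_coloring : rainbow_coloring 3 square_coloring.
Proof.
move=> S cardS.
have [S1|S1] := boolP (v1 \in S); last first.
  by apply: (square_tree_avoiding (b := v3)) S1; rewrite !inE.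
have [S3|S3] := boolP (v3 \in S); last first.
  by apply: (square_tree_avoiding (b := v1)) S3; rewrite !inE eqxx orbT.
have [S2|S2] := boolP (v2 \in S); last first.
  (* Without [v2], the hub edges form a star whose colors are distinct. *)
  have [|x|x y|H [treeH rH defA]] := @parent_tree square [set~ v2] (ord0 : V)
    (fun=> ord0) (fun x => (x : V) != ord0) square_coloring.
  - by rewrite !inE.
  - rewrite !inE => /andP [xne0 xne2]; rewrite eqxx xne0; split=> //.
    by rewrite /= /square_adj /square_arc xne0 xne2.
  - rewrite !inE => /andP [_ xne2] /andP [_ yne2].
    by rewrite !square_coloring_hub // => /val_inj.
  exists H; split=> //; rewrite defA; apply/subsetP => x xS.
  by rewrite !inE; apply: contraNneq S2 => <-.
(* Only one set is left: the path through [v2], whose two edges have colors 3 and 1. *)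
have defS : [set v1; v2; v3] = S.
  by apply/eqP; rewrite eqEcard cardS !subUset !sub1set S1 S2 S3 setUC !cardsU1 cards1 !inE.
have [|x|x y|H [treeH rH defA]] := @parent_tree square [set v1; v2; v3] v2
  (fun=> v2) (fun x => (x : V) != v2) square_coloring.
- by rewrite !inE.
- rewrite !inE => /andP [xne2]; rewrite (negbTE xne2) orbF.
  by move=> /orP [] /eqP ->.
- rewrite !inE => /andP [xne2]; rewrite (negbTE xne2) orbF => x13.
  move=> /andP [yne2]; rewrite (negbTE yne2) orbF => y13.
  rewrite ![[set _; v2]]setUC.
  by case/orP: x13 => /eqP ->; case/orP: y13 => /eqP -> //;
    rewrite square_coloring_21 square_coloring_23.
by exists H; rewrite defA -defS.
Qed.

Lemma square_connected : connected square.
Proof.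
have to0 x : connect square_adj x ord0.
  have c13 y : y != ord0 -> y != v2 -> connect square_adj y ord0.
    by move=> ne0 ne2; apply: connect1; rewrite /square_adj /square_arc ne0 ne2.
  have [->//|ne0] := eqVneq x ord0; have [->|ne2] := eqVneq x v2; last exact: c13.
  by apply: (@connect_trans _ _ v1); [apply: connect1 | apply: c13].
move=> x y; apply: connect_trans (to0 x) _.
by rewrite (sym_connect_sym square_adj_sym); apply: to0.
Qed.

Lemma square_edgeP (e : {set V}) : e \in edges square ->
  [\/ exists x : V, [/\ x != ord0, x != v2 & e = [set x; ord0]],
      e = [set v2; v1] | e = [set v2; v3]].
Proof.
case/edge_setP => x [y [/= rxy ->]].
wlog : x y {rxy} / square_arc x y => [arcE|].
  by case/orP: rxy => /arcE //; rewrite setUC.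
case/orP => [/and3P [ne0 ne2 /eqP ->]|/andP [/orP [] /eqP -> /eqP ->]].
- by constructor 1; exists x.
- by constructor 2; rewrite setUC.
- by constructor 3; rewrite setUC.
Qed.

Lemma card_square_edges_le : #|edges square| <= m.+4.
Proof.
pose B : {set {set V}} := [set [set x; ord0] | x in ~: [set ord0; v2]].
apply: (@leq_trans #|[set v2; v1] |: ([set v2; v3] |: B)|).
  apply/subset_leq_card/subsetP => e /square_edgeP [[x [ne0 ne2 ->]]|->|->].
  - have xB : [set x; ord0] \in B by apply: imset_f; rewrite !inE negb_or ne0.
    by rewrite !in_setU xB !orbT.
  - by rewrite !in_setU in_set1 eqxx.
  - by rewrite !in_setU !in_set1 eqxx orbT.
have leB : #|B| <= m.+2.
  by rewrite (leq_trans (leq_imset_card _ _)) // cardsCs setCK cards2 card_ord.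
by rewrite !cardsU1 (leq_add (leq_b1 _) (leq_add (leq_b1 _) leB)).
Qed.

Lemma square_num_colors : num_colors square_coloring <= m.+2.
Proof.
(* The colors are among 1, 3, 4, ..., [m.+3]. Color 2 does not occur, as [v2] is not adjacent to the
   hub. *)
have -> : m.+2 = size (1 :: iota 3 m.+1) by rewrite /= size_iota.
apply: uniq_leq_size; first exact: undup_uniq.
move=> k; rewrite mem_undup => /mapP [e]; rewrite mem_enum.
move=> /square_edgeP [[x [ne0 ne2 ->]]|->|->] ->; rewrite in_cons mem_iota.
- rewrite square_coloring_hub //.
  have := ltn_ord x; move: ne0 ne2; rewrite -!val_eqE /=; lia.
- by rewrite square_coloring_21.
- by rewrite square_coloring_23.
Qed.

End Examples.

Theorem proposition2p13 (n : nat) (hn : 4 <= n) :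
  is_min_size n 3 (n - 2) n /\ is_min_size n 3 (n - 1) (n - 1).
Proof.
case: n hn => [|[|[|[|m]]]] // _; rewrite !subSS !subn0.
split; split.
- have [r [rx le_r]] :=
    rainbow_index_le (@square_rainbow_coloring m) (@square_num_colors m).
  exists (square m); split.
  + exact: card_ord.
  + exact: square_connected.
  + by exists r.
  (* The square has no fewer edges than vertices by the lower bound itself, applied to its own
     rainbow index [r]. *)
  apply/eqP; rewrite eqn_leq card_square_edges_le -[X in X <= _](card_ord m.+4).
  by apply: rainbow_index_edges (@square_connected m) rx _; rewrite card_ord.
- move=> k [G [cardG conn [r [rx le_r]] <-]]; rewrite -cardG.
  by apply: rainbow_index_edges conn rx _; rewrite cardG.
- have [c rc] := star_rainbow_coloring m.
  exists (star m); split.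
  + exact: card_ord.
  + exact: star_connected.
  + by apply: rainbow_index_le rc _; rewrite -[X in _ <= X]card_star_edges num_colors_le.
  exact: card_star_edges.
- move=> k [G [cardG conn _ <-]].
  by have := connected_card_edges conn; rewrite cardG ltnS.
Qed.
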